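(* Let $C_{n,0},C_{n,1},C_{n,2},C_{n,12},C_{n,21},C_{n,121}$ ($n\ge1$) be the polynomials in $q$ defined by the expansion $$\rho\bigl((\sigma_1\sigma_2^{-1})^n\bigr)=q^{-n}\bigl(C_{n,0}+C_{n,1}T_1+C_{n,2}T_2+C_{n,12}T_1T_2+C_{n,21}T_2T_1+C_{n,121}T_1T_2T_1\bigr)$$ in the Hecke algebra $H_3$. For all $n\ge 2$ they satisfy the recursion relations \begin{align*} C_{n,0}(q)&=q^2 C_{n-1,21}(q)-q(q-1)C_{n-1,1}(q),\\ C_{n,1}(q)&=-(q-1)^2C_{n-1,1}(q)-(q-1)C_{n-1,0}(q)+q^2C_{n-1,121}(q),\\ C_{n,2}(q)&=q\,C_{n-1,1}(q),\\ C_{n,12}(q)&=(q-1)C_{n-1,1}(q)+C_{n-1,0}(q),\\ C_{n,21}(q)&=-(q-1)C_{n-1,2}(q)+q\,C_{n-1,12}(q)-(q-1)^2C_{n-1,21}(q)+q(q-1)C_{n-1,121}(q),\\ C_{n,121}(q)&=C_{n-1,2}(q)+(q-1)C_{n-1,21}(q). \end{align*}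
   Context: Work over the field $K=\mathbf{C}(q)$ (or any larger field such as $\mathbf{C}(q,z)$), with $q$ an indeterminate. The Hecke algebra $H_3$ is the associative unital $K$-algebra on generators $T_1,T_2$ with relations $T_1T_2T_1=T_2T_1T_2$ and $T_i^2=(q-1)T_i+q$ for $i=1,2$. It has dimension $6$ over $K$, with ordered basis $\{1,T_1,T_2,T_1T_2,T_2T_1,T_1T_2T_1\}$. Each $T_i$ is invertible with $T_i^{-1}=q^{-1}(T_i-(q-1))$. Let $B_3$ be the braid group on three strands with generators $\sigma_1,\sigma_2$; $\rho:B_3\to H_3$ is the multiplicative homomorphism with $\rho(\sigma_i)=T_i$. *)

(* Defs.v *)
From HB Require Import structures.
From mathcomp Require Import all_boot all_order all_algebra.
From mathcomp Require Import generic_quotient ring_quotient complex monalg.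
From mathcomp Require Import boolp reals.

Set Implicit Arguments.
Unset Strict Implicit.
Unset Printing Implicit Defensive.

Import GRing.Theory.

Local Open Scope quotient_scope.
Local Open Scope ring_scope.

(** * The braid group B_3, as a quotient of the monoid of words *)

(* The letter (i, false) is the generator number i.+1 and (i, true) is its
   formal inverse. *)
Definition braid_word := seq ('I_2 * bool).

Inductive braid_rel : braid_word -> braid_word -> Prop :=
| braid_refl u : braid_rel u u
| braid_sym u v : braid_rel u v -> braid_rel v u
| braid_trans u v w : braid_rel u v -> braid_rel v w -> braid_rel u w
| braid_cat u u' v v' :
    braid_rel u u' -> braid_rel v v' -> braid_rel (u ++ v) (u' ++ v')
| braid_cancel i e : braid_rel [:: (i, e); (i, ~~ e)] [::]
| braid_braid :
    braid_rel [:: (0, false); (1, false); (0, false)]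
              [:: (1, false); (0, false); (1, false)].

Definition braid_relb : rel braid_word := fun u v => `[< braid_rel u v >].

Lemma braid_relb_equiv : equiv_class_of braid_relb.
Proof.
split=> [u|u v|v u w].
- exact/asboolP/braid_refl.
- by apply/asboolP/asboolP; apply: braid_sym.
- move=> /asboolP uv /asboolP vw; apply/asboolP; exact: braid_trans uv vw.
Qed.
Canonical braid_equiv := EquivRelPack braid_relb_equiv.
Canonical braid_encModRel := defaultEncModRel braid_relb.

Definition B3 := {eq_quot braid_relb}.
HB.instance Definition _ : EqQuotient braid_word braid_relb B3 :=
  EqQuotient.on B3.
HB.instance Definition _ := Choice.on B3.

Lemma B3_eqP (u v : braid_word) :
  reflect (braid_rel u v) (\pi_B3 u == \pi_B3 v).
Proof. by rewrite piE; apply: asboolP. Qed.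

Definition braid_inv (u : braid_word) : braid_word :=
  rev [seq (l.1, ~~ l.2) | l <- u].

Definition B3_one : B3 := \pi_B3 [::].
Definition B3_mul (x y : B3) : B3 := \pi_B3 (repr x ++ repr y).
Definition B3_inv (x : B3) : B3 := \pi_B3 (braid_inv (repr x)).

Lemma braid_repr (u : braid_word) : braid_rel (repr (\pi_B3 u)) u.
Proof. by apply/B3_eqP; rewrite reprK. Qed.

Lemma braid_invK : involutive braid_inv.
Proof.
move=> u; rewrite /braid_inv map_rev revK -map_comp.
by rewrite -[RHS]map_id; apply: eq_map => -[i e] /=; rewrite negbK.
Qed.

Lemma braid_cat_inv (u : braid_word) : braid_rel (u ++ braid_inv u) [::].
Proof.
elim: u => [|[i e] u IHu]; first exact: braid_refl.
rewrite /braid_inv /= rev_cons -cats1 -cat1s.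
apply: (braid_trans (v := [:: (i, e)] ++ ([::] ++ [:: (i, ~~ e)]))).
  apply: braid_cat; first exact: braid_refl.
  rewrite catA; apply: braid_cat; [exact: IHu|exact: braid_refl].
exact: braid_cancel.
Qed.

Lemma braid_inv_rel (u v : braid_word) :
  braid_rel u v -> braid_rel (braid_inv u) (braid_inv v).
Proof.
move=> uv.
apply: (braid_trans (v := braid_inv u ++ (v ++ braid_inv v))).
  rewrite -[X in braid_rel X _]cats0; apply: braid_cat; first exact: braid_refl.
  exact/braid_sym/braid_cat_inv.
apply: (braid_trans (v := (braid_inv u ++ u) ++ braid_inv v)).
  rewrite catA; apply: braid_cat; last exact: braid_refl.
  by apply: braid_cat; [exact: braid_refl|exact: braid_sym].
rewrite -[X in braid_rel _ X]cat0s; apply: braid_cat; last exact: braid_refl.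
by rewrite -[X in _ ++ X]braid_invK; apply: braid_cat_inv.
Qed.

Lemma B3_mul_pi (u v : braid_word) :
  B3_mul (\pi_B3 u) (\pi_B3 v) = \pi_B3 (u ++ v).
Proof. by apply/eqP/B3_eqP/braid_cat; apply: braid_repr. Qed.

Lemma B3_inv_pi (u : braid_word) : B3_inv (\pi_B3 u) = \pi_B3 (braid_inv u).
Proof. exact/eqP/B3_eqP/braid_inv_rel/braid_repr. Qed.

Lemma B3_mulA : associative B3_mul.
Proof.
elim/quotW=> u; elim/quotW=> v; elim/quotW=> w.
by rewrite (B3_mul_pi v w) (B3_mul_pi u v) 2!B3_mul_pi catA.
Qed.

Lemma B3_mul1g : left_id B3_one B3_mul.
Proof. by elim/quotW=> u; rewrite B3_mul_pi. Qed.

Lemma B3_mulg1 : right_id B3_one B3_mul.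
Proof. by elim/quotW=> u; rewrite B3_mul_pi cats0. Qed.

Lemma B3_mulgV : right_inverse B3_one B3_inv B3_mul.
Proof.
elim/quotW=> u; rewrite B3_inv_pi B3_mul_pi.
exact/eqP/B3_eqP/braid_cat_inv.
Qed.

Lemma B3_mulVg : left_inverse B3_one B3_inv B3_mul.
Proof.
elim/quotW=> u; rewrite B3_inv_pi B3_mul_pi; apply/eqP/B3_eqP.
by rewrite -[X in _ ++ X]braid_invK; apply: braid_cat_inv.
Qed.

HB.instance Definition _ :=
  isGroup.Build B3 B3_mulA B3_mul1g B3_mulg1 B3_mulVg B3_mulgV.

Definition sigma (i : 'I_2) : B3 := \pi_B3 [:: (i, false)].
Definition sigma1 : B3 := sigma 0.
Definition sigma2 : B3 := sigma 1.

Lemma B3_piM (u v : braid_word) :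
  (\pi_B3 u * \pi_B3 v)%g = \pi_B3 (u ++ v).
Proof. exact: B3_mul_pi. Qed.

Lemma B3_piV (u : braid_word) : ((\pi_B3 u)^-1)%g = \pi_B3 (braid_inv u).
Proof. exact: B3_inv_pi. Qed.

Lemma sigma_braid :
  (sigma1 * sigma2 * sigma1 = sigma2 * sigma1 * sigma2)%g.
Proof.
rewrite /sigma1 /sigma2 /sigma !B3_piM; apply/eqP/B3_eqP.
exact: braid_braid.
Qed.

(** * The Hecke algebra H_3, as a quotient of the free algebra *)

Section HeckeAlgebra.
Variables (K : fieldType) (q : K).

Definition free_alg2 : lalgType K := {malg K[{fmonom 'I_2}]}.

Lemma free_alg2_scalerAr (c : K) (x y : free_alg2) :
  c *: (x * y) = x * (c *: y).
Proof.
have comm (z : {malg K[{fmonom 'I_2}]}) : z * c%:MP = c%:MP * z.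
  rewrite [LHS]malgM_def [RHS]malgM_def fgmulgU fgmulUg.
  by apply: eq_bigr => m _; rewrite mulrC mulm1 mul1m.
have cE (z : free_alg2) : c *: z = (c%:MP : free_alg2) * z.
  exact/esym/mul_malgC.
have commF (z : free_alg2) : z * (c%:MP : free_alg2) = (c%:MP : free_alg2) * z.
  exact: comm.
by rewrite !cE !mulrA commF.
Qed.

Definition free_gen (i : 'I_2) : free_alg2 :=
  << fmu i >> : {malg K[{fmonom 'I_2}]}.

Section FreeLift.
Variables (A : algType K) (a : 'I_2 -> A).

Definition mon_lift (m : {fmonom 'I_2}) : A := \prod_(i <- (m : seq 'I_2)) a i.

Lemma mon_lift_mmorphism : mmorphism mon_lift.
Proof.
by split=> [m1 m2|]; rewrite /mon_lift ?fmM ?fm1 ?big_cat ?big_nil.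
Qed.
HB.instance Definition _ :=
  isMultiplicative.Build {fmonom 'I_2} A mon_lift mon_lift_mmorphism.

Definition free_lift (x : free_alg2) : A := mmap (in_alg A) mon_lift x.

Lemma free_lift_zmod_morphism : zmod_morphism free_lift.
Proof. exact: (raddfB (mmap (in_alg A) mon_lift)). Qed.

Lemma free_lift_monoid_morphism : monoid_morphism free_lift.
Proof.
have [|M1 M2] := @commr_mmap_is_multiplicative _ _ _ (in_alg A) mon_lift.
  by move=> g m m'; rewrite /GRing.comm /= mulr_algl mulr_algr.
by split; [exact: M2|exact: M1].
Qed.

Lemma free_lift_scalable : scalable free_lift.
Proof.
move=> c x; rewrite -[RHS]mulr_algl.
exact: (mmapZ (f := in_alg A) (h := mon_lift)).
Qed.

HB.instance Definition _ :=
  GRing.isZmodMorphism.Build free_alg2 A free_lift free_lift_zmod_morphism.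
HB.instance Definition _ :=
  GRing.isMonoidMorphism.Build free_alg2 A free_lift free_lift_monoid_morphism.
HB.instance Definition _ :=
  GRing.isScalable.Build K free_alg2 A *:%R free_lift free_lift_scalable.

Lemma free_lift_gen (i : 'I_2) : free_lift (free_gen i) = a i.
Proof.
rewrite /free_lift [LHS](mmapU (f := in_alg A)) /= scale1r mul1r /mon_lift.
by rewrite fmU big_seq1.
Qed.

End FreeLift.

Inductive hecke_relator : free_alg2 -> Prop :=
| hecke_relator_braid :
    hecke_relator (free_gen 0 * free_gen 1 * free_gen 0
                   - free_gen 1 * free_gen 0 * free_gen 1)
| hecke_relator_quad i :
    hecke_relator (free_gen i ^+ 2 - ((q - 1) *: free_gen i + q%:A)).

(* The two-sided ideal generated by the relators. *)
Inductive hecke_ideal : free_alg2 -> Prop :=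
| hecke_ideal0 : hecke_ideal 0
| hecke_idealD x y : hecke_ideal x -> hecke_ideal y -> hecke_ideal (x + y)
| hecke_ideal_gen a r b : hecke_relator r -> hecke_ideal (a * r * b).

Lemma hecke_idealM a x b : hecke_ideal x -> hecke_ideal (a * x * b).
Proof.
elim=> [|{}x y _ IHx _ IHy|c r d rel_r].
- by rewrite mulr0 mul0r; apply: hecke_ideal0.
- by rewrite mulrDr mulrDl; apply: hecke_idealD.
- by rewrite !mulrA -[_ * d * b]mulrA; apply: hecke_ideal_gen.
Qed.

Definition hecke_idealb : {pred free_alg2} := fun x => `[< hecke_ideal x >].

Lemma hecke_ideal_zmod_closed : zmod_closed hecke_idealb.
Proof.
split=> [|x y]; first exact/asboolP/hecke_ideal0.
move=> /asboolP Ix /asboolP Iy; apply/asboolP/hecke_idealD => //.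
by have := hecke_idealM (- 1) 1 Iy; rewrite mulr1 mulN1r.
Qed.
HB.instance Definition _ :=
  GRing.isZmodClosed.Build free_alg2 hecke_idealb hecke_ideal_zmod_closed.

Definition H3 := Quotient.quot hecke_idealb.
HB.instance Definition _ := GRing.Zmodule.on H3.

(* H3_pi, and below H3_mul and H3_scale, are locked because unfolding them to
   compare two elements of H3 up to conversion is intractable. *)
Definition H3_pi : free_alg2 -> H3 := locked \pi_H3.

Lemma H3_eqP (x y : free_alg2) :
  reflect (hecke_ideal (x - y)) (H3_pi x == H3_pi y).
Proof. by rewrite /H3_pi -lock -Quotient.idealrBE; apply: asboolP. Qed.

Lemma H3_reprK (x : H3) : H3_pi (repr x) = x.
Proof. rewrite /H3_pi -lock; exact: reprK. Qed.

Lemma H3_reprP (x : free_alg2) : hecke_ideal (repr (H3_pi x) - x).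
Proof. by apply/H3_eqP; rewrite H3_reprK. Qed.

Lemma H3_piD (x y : free_alg2) : H3_pi (x + y) = H3_pi x + H3_pi y.
Proof. rewrite /H3_pi -lock; exact: Quotient.pi_add. Qed.

Lemma H3_piN (x : free_alg2) : H3_pi (- x) = - H3_pi x.
Proof. rewrite /H3_pi -lock; exact: Quotient.pi_opp. Qed.

Lemma H3_ind (P : H3 -> Prop) : (forall x, P (H3_pi x)) -> forall x, P x.
Proof. by move=> Ppi x; rewrite -[x]H3_reprK. Qed.

Definition H3_one : H3 := H3_pi 1.
Definition H3_mul : H3 -> H3 -> H3 :=
  locked (fun x y => H3_pi (repr x * repr y)).
Definition H3_scale : K -> H3 -> H3 := locked (fun c x => H3_pi (c *: repr x)).

Lemma H3_mul_pi (x y : free_alg2) :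
  H3_mul (H3_pi x) (H3_pi y) = H3_pi (x * y).
Proof.
rewrite /H3_mul -lock; apply/eqP/H3_eqP; set x' := repr _; set y' := repr _.
have -> : x' * y' - x * y = 1 * (x' - x) * y' + x * (y' - y) * 1.
  by rewrite mul1r mulr1 mulrBl mulrBr addrA subrK.
by apply: hecke_idealD; apply: hecke_idealM; apply: H3_reprP.
Qed.

Lemma H3_scale_pi (c : K) (x : free_alg2) :
  H3_scale c (H3_pi x) = H3_pi (c *: x).
Proof.
rewrite /H3_scale -lock; apply/eqP/H3_eqP.
rewrite -scalerBr -[_ - x]mul1r -[X in hecke_ideal X]mulr1.
by rewrite scalerAl; apply/hecke_idealM/H3_reprP.
Qed.

Lemma H3_mulA : associative H3_mul.
Proof.
elim/H3_ind=> x; elim/H3_ind=> y; elim/H3_ind=> z.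
by rewrite (H3_mul_pi y z) (H3_mul_pi x y) 2!H3_mul_pi mulrA.
Qed.

Lemma H3_mul1 : left_id H3_one H3_mul.
Proof. by elim/H3_ind=> x; rewrite H3_mul_pi mul1r. Qed.

Lemma H3_1mul : right_id H3_one H3_mul.
Proof. by elim/H3_ind=> x; rewrite H3_mul_pi mulr1. Qed.

Lemma H3_mulDl : left_distributive H3_mul +%R.
Proof.
elim/H3_ind=> x; elim/H3_ind=> y; elim/H3_ind=> z.
by rewrite -H3_piD !H3_mul_pi -H3_piD mulrDl.
Qed.

Lemma H3_mulDr : right_distributive H3_mul +%R.
Proof.
elim/H3_ind=> x; elim/H3_ind=> y; elim/H3_ind=> z.
by rewrite -H3_piD !H3_mul_pi -H3_piD mulrDr.
Qed.

Definition hecke_relations (A : algType K) (a : 'I_2 -> A) : Prop :=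
  a 0 * a 1 * a 0 = a 1 * a 0 * a 1 /\
  forall i, a i ^+ 2 = (q - 1) *: a i + q%:A.

Lemma lift_braid (F A : lalgType K) (f : {lrmorphism F -> A}) (u v : F) :
  f u * f v * f u = f v * f u * f v -> f (u * v * u - v * u * v) = 0.
Proof. by move=> e; rewrite rmorphB !rmorphM /= e subrr. Qed.

Lemma lift_quad (F A : lalgType K) (f : {lrmorphism F -> A}) (u : F) :
  f u ^+ 2 = (q - 1) *: f u + q%:A -> f (u ^+ 2 - ((q - 1) *: u + q%:A)) = 0.
Proof.
by move=> e; rewrite rmorphB rmorphD rmorphXn /= !linearZ /= rmorph1 e subrr.
Qed.

Lemma free_lift_relator (A : algType K) (a : 'I_2 -> A) (r : free_alg2) :
  hecke_relations a -> hecke_relator r -> free_lift a r = 0.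
Proof.
case=> braid quad; elim=> [|i].
- by apply: (lift_braid (f := free_lift a)); rewrite /= !free_lift_gen.
- by apply: (lift_quad (f := free_lift a)); rewrite /= free_lift_gen.
Qed.

Lemma free_lift_ideal (A : algType K) (a : 'I_2 -> A) (x : free_alg2) :
  hecke_relations a -> hecke_ideal x -> free_lift a x = 0.
Proof.
move=> rel; elim=> [|y z _ IHy _ IHz|y r z rel_r]; first exact: raddf0.
- by rewrite raddfD /= IHy IHz addr0.
- rewrite (rmorphM (free_lift a)) (rmorphM (free_lift a) y) /=.
  by rewrite (free_lift_relator rel rel_r) mulr0 mul0r.
Qed.

(* H3 is nontrivial: T_1, T_2 |-> q defines an algebra morphism to K. *)
Lemma H3_1neq0 : H3_one != 0.
Proof.
apply/negP; rewrite [0](_ : _ = H3_pi 0); last first.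
  by rewrite -[0 in RHS](subrr 0) H3_piD H3_piN subrr.
move=> /H3_eqP; rewrite subr0 => /(@free_lift_ideal K^o (fun=> q)) e.
have: (1 : K^o) = 0.
  rewrite -[RHS]e ?(rmorph1 (free_lift _)) //; split=> // i.
  have e2 : q ^+ 2 = (q - 1) * q + q * 1 by rewrite mulrBl mul1r mulr1 subrK.
  exact: e2.
by move/eqP; rewrite oner_eq0.
Qed.

HB.instance Definition _ := GRing.Zmodule_isNzRing.Build H3
  H3_mulA H3_mul1 H3_1mul H3_mulDl H3_mulDr H3_1neq0.

Lemma H3_scaleA a b x : H3_scale a (H3_scale b x) = H3_scale (a * b) x.
Proof. by elim/H3_ind: x => x; rewrite !H3_scale_pi scalerA. Qed.

Lemma H3_scale1 : left_id 1 H3_scale.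
Proof. by elim/H3_ind=> x; rewrite H3_scale_pi scale1r. Qed.

Lemma H3_scaleDr : right_distributive H3_scale +%R.
Proof.
move=> a; elim/H3_ind=> x; elim/H3_ind=> y.
by rewrite -H3_piD !H3_scale_pi -H3_piD scalerDr.
Qed.

Lemma H3_scaleDl x : {morph H3_scale^~ x : a b / a + b}.
Proof.
by elim/H3_ind: x => x a b; rewrite !H3_scale_pi -H3_piD scalerDl.
Qed.

HB.instance Definition _ := GRing.Zmodule_isLmodule.Build K H3
  H3_scaleA H3_scale1 H3_scaleDr H3_scaleDl.

Lemma H3_piM (x y : free_alg2) : H3_pi (x * y) = H3_pi x * H3_pi y.
Proof. by rewrite -H3_mul_pi. Qed.

Lemma H3_pi1 : H3_pi 1 = 1.
Proof. by []. Qed.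

Lemma H3_piZ (c : K) (x : free_alg2) : H3_pi (c *: x) = c *: H3_pi x.
Proof. by rewrite -H3_scale_pi. Qed.

Lemma H3_scaleAl (a : K) (x y : H3) : a *: (x * y) = (a *: x) * y.
Proof.
elim/H3_ind: x => x; elim/H3_ind: y => y.
by rewrite -H3_piM -!H3_piZ -H3_piM scalerAl.
Qed.
HB.instance Definition _ := GRing.Lmodule_isLalgebra.Build K H3 H3_scaleAl.

Lemma H3_scaleAr (a : K) (x y : H3) : a *: (x * y) = x * (a *: y).
Proof.
elim/H3_ind: x => x; elim/H3_ind: y => y.
by rewrite -H3_piM -!H3_piZ -H3_piM free_alg2_scalerAr.
Qed.
HB.instance Definition _ := GRing.Lalgebra_isAlgebra.Build K H3 H3_scaleAr.

Definition Tgen (i : 'I_2) : H3 := H3_pi (free_gen i).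
Definition Tinv (i : 'I_2) : H3 := q^-1 *: (Tgen i - (q - 1)%:A).

Lemma H3_piM3 (x y z : free_alg2) :
  H3_pi (x * y * z) = H3_pi x * H3_pi y * H3_pi z.
Proof. by rewrite !H3_piM. Qed.

Lemma H3_pi_relator (x y : free_alg2) :
  hecke_relator (x - y) -> H3_pi x = H3_pi y.
Proof.
move=> rel; apply/eqP/H3_eqP; rewrite -[X in hecke_ideal X]mulr1 -[_ - _]mul1r.
exact: hecke_ideal_gen.
Qed.

Lemma T_braid : Tgen 0 * Tgen 1 * Tgen 0 = Tgen 1 * Tgen 0 * Tgen 1.
Proof.
apply: (etrans (esym (H3_piM3 _ _ _))); apply: (etrans _ (H3_piM3 _ _ _)).
exact/H3_pi_relator/hecke_relator_braid.
Qed.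

Lemma H3_pi_quad (x : free_alg2) :
  H3_pi (x ^+ 2) = H3_pi ((q - 1) *: x + q%:A) ->
  H3_pi x ^+ 2 = (q - 1) *: H3_pi x + q%:A.
Proof.
have piS : H3_pi ((q - 1) *: x + q%:A) = (q - 1) *: H3_pi x + q%:A.
  apply: (etrans (H3_piD _ _)); congr (_ + _); first exact: H3_piZ.
  exact: H3_piZ.
by move=> e; apply: (etrans (esym (H3_piM x x))); rewrite -piS.
Qed.

Lemma T_quad (i : 'I_2) : Tgen i ^+ 2 = (q - 1) *: Tgen i + q%:A.
Proof. exact: (H3_pi_quad (H3_pi_relator (hecke_relator_quad i))). Qed.

(* The universal property of the presentation. *)
Section Lift.
Variables (A : algType K) (a : 'I_2 -> A).
Hypothesis rel_a : hecke_relations a.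

Definition H3_lift (x : H3) : A := free_lift a (repr x).

Lemma H3_lift_pi (x : free_alg2) : H3_lift (H3_pi x) = free_lift a x.
Proof.
by apply/eqP; rewrite -subr_eq0 -raddfB; apply/eqP/free_lift_ideal/H3_reprP.
Qed.

Lemma H3_lift_T (i : 'I_2) : H3_lift (Tgen i) = a i.
Proof. by rewrite H3_lift_pi free_lift_gen. Qed.

Lemma H3_lift1 : H3_lift 1 = 1.
Proof. by rewrite -H3_pi1 H3_lift_pi rmorph1. Qed.

Lemma H3_liftD (x y : H3) : H3_lift (x + y) = H3_lift x + H3_lift y.
Proof.
elim/H3_ind: x => x; elim/H3_ind: y => y.
by rewrite -H3_piD !H3_lift_pi raddfD.
Qed.

Lemma H3_liftM (x y : H3) : H3_lift (x * y) = H3_lift x * H3_lift y.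
Proof.
elim/H3_ind: x => x; elim/H3_ind: y => y.
by rewrite -H3_piM !H3_lift_pi rmorphM.
Qed.

Lemma H3_liftZ (c : K) (x : H3) : H3_lift (c *: x) = c *: H3_lift x.
Proof. by elim/H3_ind: x => x; rewrite -H3_piZ !H3_lift_pi linearZ. Qed.

End Lift.

Lemma T_TinvK (i : 'I_2) : q != 0 -> Tgen i * Tinv i = 1.
Proof.
move=> q0; rewrite /Tinv -scalerAr mulrBr -expr2 T_quad -scalerAr mulr1.
by rewrite addrAC subrr add0r scalerA mulVf // scale1r.
Qed.

Lemma Tinv_TK (i : 'I_2) : q != 0 -> Tinv i * Tgen i = 1.
Proof.
move=> q0; rewrite /Tinv -scalerAl mulrBl -expr2 T_quad -scalerAl mul1r.
by rewrite addrAC subrr add0r scalerA mulVf // scale1r.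
Qed.

Definition rho_letter (l : 'I_2 * bool) : H3 :=
  if l.2 then Tinv l.1 else Tgen l.1.

Definition rho_word (u : braid_word) : H3 := \prod_(l <- u) rho_letter l.

(* This does not depend on the representing word, and is a morphism, as soon as
   q != 0; see rho_pi, rho1 and rhoM. *)
Definition rho (x : B3) : H3 := rho_word (repr x).

Section RhoMorphism.
Hypothesis q_neq0 : q != 0.

Lemma rho_word_rel (u v : braid_word) :
  braid_rel u v -> rho_word u = rho_word v.
Proof.
elim=> {u v} [//|u v _ -> //|u v w _ -> _ -> //|u u' v v' _ IHu _ IHv|i e|].
- by rewrite /rho_word !big_cat /=; congr (_ * _).
- rewrite /rho_word big_cons big_seq1 big_nil /rho_letter /=.
  by case: e; [apply: Tinv_TK|apply: T_TinvK].
- by rewrite /rho_word !big_cons big_nil /rho_letter /= !mulr1 !mulrA T_braid.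
Qed.

Lemma rho_pi (u : braid_word) : rho (\pi_B3 u) = rho_word u.
Proof. exact/rho_word_rel/braid_repr. Qed.

Lemma rho_sigma (i : 'I_2) : rho (sigma i) = Tgen i.
Proof. by rewrite rho_pi /rho_word big_seq1. Qed.

Lemma rho1 : rho 1%g = 1.
Proof. by rewrite [LHS](rho_pi [::]) /rho_word big_nil. Qed.

Lemma rhoM (x y : B3) : rho (x * y)%g = rho x * rho y.
Proof.
elim/quotW: x => u; elim/quotW: y => v.
by rewrite B3_piM !rho_pi /rho_word big_cat.
Qed.

End RhoMorphism.

End HeckeAlgebra.

(** * The expansion of rho ((sigma_1 sigma_2^-1)^n) *)

Record hecke_coefs (A : Type) := HeckeCoefs {
  c_0 : A; c_1 : A; c_2 : A; c_12 : A; c_21 : A; c_121 : A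
}.

Section Expansion.
(* K is any extension field of C(q). *)
Variables (R : realType) (K : fieldType).
Variable iota : {rmorphism {fraction {poly R[i]}} -> K}.

Definition poly_in (p : {poly R[i]}) : K := iota (tofrac p).
Definition q_in : K := poly_in 'X.

Definition T1 : H3 q_in := Tgen q_in 0.
Definition T2 : H3 q_in := Tgen q_in 1.

Lemma q_in_neq0 : q_in != 0.
Proof. by rewrite fmorph_eq0 tofrac_eq0 polyX_eq0. Qed.

Definition is_expansion (n : nat) (c : hecke_coefs {poly R[i]}) : Prop :=
  rho q_in ((sigma1 * sigma2^-1) ^+ n)%g =
  q_in ^- n *: ((poly_in (c_0 c))%:A
                + poly_in (c_1 c) *: T1
                + poly_in (c_2 c) *: T2
                + poly_in (c_12 c) *: (T1 * T2)
                + poly_in (c_21 c) *: (T2 * T1)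
                + poly_in (c_121 c) *: (T1 * T2 * T1)).

End Expansion.

(* Main.v *)
(* Right multiplication by T_1 and T_2 acts on the coordinates with respect to
   1, T_1, T_2, T_1T_2, T_2T_1, T_1T_2T_1 by explicit linear maps.  Since
   T_1 T_2^-1 = q^-1 T_1 (T_2 - (q - 1)), composing them gives the recursion
   once the coordinates are known to be unique.  For this, the same two maps are
   6x6 matrices satisfying the Hecke relations, so they define a representation
   of H_3; applying it to the first basis vector reads off the coordinates. *)
Require Import Defs.
From HB Require Import structures.
From mathcomp Require Import all_boot all_order all_algebra.
From mathcomp Require Import complex reals ring.

Set Implicit Arguments.
Unset Strict Implicit.
Unset Printing Implicit Defensive.

Import GRing.Theory.

Local Open Scope ring_scope.

(** * Coefficient sextuples and the recursion as a map on them *)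

Definition hecke_step (A : comNzRingType) (q : A) (c : hecke_coefs A) :
    hecke_coefs A :=
  HeckeCoefs
    (q ^+ 2 * c_21 c - q * (q - 1) * c_1 c)
    (- (q - 1) ^+ 2 * c_1 c - (q - 1) * c_0 c + q ^+ 2 * c_121 c)
    (q * c_1 c)
    ((q - 1) * c_1 c + c_0 c)
    (- (q - 1) * c_2 c + q * c_12 c
     - (q - 1) ^+ 2 * c_21 c + q * (q - 1) * c_121 c)
    (c_2 c + (q - 1) * c_21 c).

Definition map_coefs (A B : Type) (f : A -> B) (c : hecke_coefs A) :
    hecke_coefs B :=
  HeckeCoefs (f (c_0 c)) (f (c_1 c)) (f (c_2 c)) (f (c_12 c)) (f (c_21 c))
    (f (c_121 c)).

Lemma map_coefs_inj (A B : Type) (f : A -> B) :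
  injective f -> injective (map_coefs f).
Proof.
by move=> f_inj [? ? ? ? ? ?] [? ? ? ? ? ?] [] /f_inj -> /f_inj -> /f_inj ->
  /f_inj -> /f_inj -> /f_inj ->.
Qed.

(** Needed because the recursion is claimed over the polynomials while expansions live over [K]. *)
Lemma map_hecke_step (A B : comNzRingType) (f : {rmorphism A -> B}) (q : A)
    (c : hecke_coefs A) :
  map_coefs f (hecke_step q c) = hecke_step (f q) (map_coefs f c).
Proof.
rewrite /map_coefs /hecke_step /=.
by congr HeckeCoefs;
  rewrite ?(rmorphB, rmorphD, rmorphN, rmorphM, rmorphXn, rmorph1).
Qed.

Definition hecke_comb (K : fieldType) (A : algType K) (a : 'I_2 -> A)
    (c : hecke_coefs K) : A :=
  (c_0 c)%:A + c_1 c *: a 0 + c_2 c *: a 1 + c_12 c *: (a 0 * a 1)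
  + c_21 c *: (a 1 * a 0) + c_121 c *: (a 0 * a 1 * a 0).

Definition coefs_lin (A : nzRingType) (k : A) (c d : hecke_coefs A) :
    hecke_coefs A :=
  HeckeCoefs (k * c_0 c + c_0 d) (k * c_1 c + c_1 d) (k * c_2 c + c_2 d)
    (k * c_12 c + c_12 d) (k * c_21 c + c_21 d) (k * c_121 c + c_121 d).

(* Coordinates of [h * T_{i+1}], where [c] are those of [h]: the index [i]
   counts the generators from 0. *)
Definition coefs_mulT (A : nzRingType) (q : A) (i : 'I_2) (c : hecke_coefs A) :
    hecke_coefs A :=
  if i == 0 then
    HeckeCoefs (c_1 c * q) (c_0 c + c_1 c * (q - 1)) (c_21 c * q)
      (c_121 c * q) (c_2 c + c_21 c * (q - 1)) (c_12 c + c_121 c * (q - 1))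
  else
    HeckeCoefs (c_2 c * q) (c_12 c * q) (c_0 c + c_2 c * (q - 1))
      (c_1 c + c_12 c * (q - 1)) (c_121 c * q) (c_21 c + c_121 c * (q - 1)).

(** Coordinate form of $T_1(T_2-(q-1)) = T_1T_2-(q-1)T_1$. *)
Lemma hecke_step_mulT (A : comNzRingType) (q : A) (c : hecke_coefs A) :
  hecke_step q c = coefs_lin (- (q - 1)) (coefs_mulT q 0 c)
                     (coefs_mulT q 1 (coefs_mulT q 0 c)).
Proof.
by rewrite /hecke_step /coefs_lin /coefs_mulT /=; congr HeckeCoefs; ring.
Qed.

Lemma coefs_mulT_lin (A : comNzRingType) (q : A) (i : 'I_2) (k : A)
    (c d : hecke_coefs A) :
  coefs_mulT q i (coefs_lin k c d) =
  coefs_lin k (coefs_mulT q i c) (coefs_mulT q i d).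
Proof.
by rewrite /coefs_mulT /coefs_lin; case: ifP => _ /=; congr HeckeCoefs; ring.
Qed.

(** * Coordinates in any algebra satisfying the Hecke relations *)

Section HeckeRelations.
Variables (K : fieldType) (q : K) (A : algType K) (a : 'I_2 -> A).

Lemma hecke_comb_lin (k : K) (c d : hecke_coefs K) :
  hecke_comb a (coefs_lin k c d) = k *: hecke_comb a c + hecke_comb a d.
Proof.
rewrite /hecke_comb !scalerDl !scalerDr !scalerA !addrA.
by rewrite [RHS](ACl (1 * 7 * 2 * 8 * 3 * 9 * 4 * 10 * 5 * 11 * 6 * 12)).
Qed.

Hypothesis rel_a : hecke_relations q a.

Lemma hecke_comb_mulT (i : 'I_2) (c : hecke_coefs K) :
  hecke_comb a (coefs_mulT q i c) = hecke_comb a c * a i.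
Proof.
have [braid quad] := rel_a; set x := a 0; set y := a 1.
have xx : x * x = (q - 1) *: x + q%:A by rewrite -expr2 quad.
have yy : y * y = (q - 1) *: y + q%:A by rewrite -expr2 quad.
have yxx : y * x * x = (q - 1) *: (y * x) + q *: y.
  by rewrite -mulrA xx mulrDr -!scalerAr mulr1.
have xyxx : x * y * x * x = (q - 1) *: (x * y * x) + q *: (x * y).
  by rewrite -!mulrA [y * _]mulrA yxx mulrDr -!scalerAr.
have xyy : x * y * y = (q - 1) *: (x * y) + q *: x.
  by rewrite -mulrA yy mulrDr -!scalerAr mulr1.
have xyxy : x * y * x * y = (q - 1) *: (x * y * x) + q *: (y * x).
  (* The braid relation gives $x(yxy) = x(xyx)$, which exposes the square $xx$. *)
  rewrite -!mulrA [y * (x * y)]mulrA -braid -/x -/y !mulrA xx !mulrDl.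
  by rewrite -!scalerAl mul1r.
rewrite /hecke_comb /coefs_mulT -/x -/y.
(* [q - 1] is made opaque so that [scalerDl] does not split it. *)
set p := q - 1 in xx yxx xyxx yy xyy xyxy *.
clearbody p; case: ifPn => [/eqP ->|i0] /=.
  rewrite -/x !mulrDl -!scalerAl mul1r xx yxx xyxx !scalerDr !scalerDl.
  by rewrite !scalerA !addrA [RHS](ACl (3 * 1 * 2 * 7 * 9 * 4 * 6 * 5 * 8)).
have -> : a i = y.
  by rewrite /y; congr (a _); apply: val_inj; case: i i0 => -[|[|?]].
rewrite !mulrDl -!scalerAl mul1r yy xyy -braid xyxy !scalerDr !scalerDl.
by rewrite !scalerA !addrA [RHS](ACl (4 * 6 * 1 * 3 * 2 * 5 * 9 * 7 * 8)).
Qed.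

Lemma hecke_comb_step (c : hecke_coefs K) :
  hecke_comb a (hecke_step q c) = hecke_comb a c * (a 0 * (a 1 - (q - 1)%:A)).
Proof.
rewrite hecke_step_mulT hecke_comb_lin !hecke_comb_mulT mulrA mulrBr.
by rewrite -scalerAr mulr1 scaleNr addrC.
Qed.

End HeckeRelations.

(** * The right regular representation by 6x6 matrices *)

Section RegularRepresentation.
Variables (K : fieldType) (q : K).

Definition coefs_row (c : hecke_coefs K) : 'rV[K]_6 :=
  \row_j [:: c_0 c; c_1 c; c_2 c; c_12 c; c_21 c; c_121 c]`_j.

Definition row_coefs (v : 'rV[K]_6) : hecke_coefs K :=
  HeckeCoefs (v 0 0) (v 0 1) (v 0 2) (v 0 3) (v 0 4) (v 0 5).

Lemma coefs_rowK : cancel coefs_row row_coefs.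
Proof. by case=> *; rewrite /row_coefs !mxE. Qed.

Lemma row_coefsK : cancel row_coefs coefs_row.
Proof.
move=> v; apply/rowP => j; rewrite mxE /=.
by case: j => -[|[|[|[|[|[|//]]]]]] jP /=; congr (v 0 _); apply: val_inj.
Qed.

Lemma coefs_row_lin (k : K) (c d : hecke_coefs K) :
  coefs_row (coefs_lin k c d) = k *: coefs_row c + coefs_row d.
Proof.
by apply/rowP => -[[|[|[|[|[|[|//]]]]]] jP]; rewrite !mxE.
Qed.

Definition regular_fun (i : 'I_2) (v : 'rV[K]_6) : 'rV[K]_6 :=
  coefs_row (coefs_mulT q i (row_coefs v)).

Lemma regular_fun_linear (i : 'I_2) : linear (regular_fun i).
Proof.
move=> k u v; rewrite /regular_fun -coefs_row_lin -coefs_mulT_lin.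
by rewrite /row_coefs !mxE.
Qed.
HB.instance Definition _ (i : 'I_2) :=
  GRing.isLinear.Build K 'rV[K]_6 'rV[K]_6 *:%R (regular_fun i)
    (regular_fun_linear i).

(** Acting on row vectors makes matrix products compose in the same order as right multiplications,
    so no opposite algebra appears. *)
Definition regular_mx (i : 'I_2) : 'M[K]_6 := lin1_mx (regular_fun i).

Lemma coefs_row_mul (c : hecke_coefs K) (i : 'I_2) :
  coefs_row c *m regular_mx i = coefs_row (coefs_mulT q i c).
Proof. by rewrite mul_rV_lin1 /= /regular_fun coefs_rowK. Qed.

Lemma regular_mx_eq (M N : 'M[K]_6) :
  (forall c, coefs_row c *m M = coefs_row c *m N) -> M = N.
Proof.
move=> eqMN; apply/row_matrixP => i.
by rewrite !rowE -[delta_mx _ _]row_coefsK.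
Qed.

Lemma regular_mx_relations : hecke_relations q regular_mx.
Proof.
split=> [|i]; apply: regular_mx_eq => c.
  rewrite -!mulmxE !mulmxA !coefs_row_mul /coefs_mulT /=; congr coefs_row.
  by congr HeckeCoefs; ring.
rewrite expr2 -mulmxE mulmxA mulmxDr -!scalemxAr mulmx1 !coefs_row_mul.
apply/rowP => j; rewrite !mxE /coefs_mulT.
by case: (i == 0); case: j => -[|[|[|[|[|[|//]]]]]] jP /=; ring.
Qed.

(** The row on the left is the coordinate vector of $1$, and $1 \cdot h = h$. *)
Lemma regular_mx_comb (c : hecke_coefs K) :
  coefs_row (HeckeCoefs 1 0 0 0 0 0) *m hecke_comb regular_mx c = coefs_row c.
Proof.
rewrite /hecke_comb !mulmxDr -!scalemxAr mulmx1 -!mulmxE !mulmxA !coefs_row_mul.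
by apply/rowP => -[[|[|[|[|[|[|//]]]]]] jP]; rewrite !mxE /=; ring.
Qed.

End RegularRepresentation.

(** Linear independence of the six words in $H_3$: the universal property sends a combination to its
    matrix, whose action on the coordinates of $1$ recovers the coefficients. *)
Lemma hecke_comb_inj (K : fieldType) (q : K) :
  injective (hecke_comb (Tgen q)).
Proof.
move=> c d eq_cd; apply: (can_inj (@coefs_rowK K)).
have rel := regular_mx_relations q.
have liftE e : H3_lift (regular_mx q) (hecke_comb (Tgen q) e)
    = hecke_comb (regular_mx q) e.
  by rewrite /hecke_comb !(H3_liftD rel, H3_liftZ rel, H3_liftM rel,
    H3_lift1 rel, H3_lift_T rel).
by rewrite -(regular_mx_comb q c) -(regular_mx_comb q d) -!liftE eq_cd.
Qed.

(** * Existence and uniqueness of the polynomial expansion *)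

Section Expansion.
Variables (R : realType) (K : fieldType).
Variable iota : {rmorphism {fraction {poly R[i]}} -> K}.
Let q := q_in iota.

Definition poly_in_rmorphism : {rmorphism {poly R[i]} -> K} :=
  iota \o @tofrac {poly R[i]}.

Lemma is_expansionE (n : nat) (c : hecke_coefs {poly R[i]}) :
  is_expansion iota n c <->
  rho q ((sigma1 * sigma2^-1) ^+ n)%g =
  q ^- n *: hecke_comb (Tgen q) (map_coefs (poly_in iota) c).
Proof. by []. Qed.

(** The scalar $q^{-n}$ is nonzero, the six words are independent, and $\mathbf{C}[q]$ embeds in
    [K]. *)
Lemma is_expansion_uniq (n : nat) (c d : hecke_coefs {poly R[i]}) :
  is_expansion iota n c -> is_expansion iota n d -> c = d.
Proof.
rewrite !is_expansionE => -> /scalerI eq_cd.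
apply: (@map_coefs_inj _ _ (poly_in iota)).
  by move=> u v /fmorph_inj /eqP; rewrite tofrac_eq => /eqP.
by apply/hecke_comb_inj/eq_cd; rewrite invr_eq0 expf_neq0 // q_in_neq0.
Qed.

Lemma rho_sigmaV (i : 'I_2) : rho q (sigma i)^-1%g = Tinv q i.
Proof.
by rewrite /sigma B3_piV rho_pi ?q_in_neq0 // /rho_word big_seq1.
Qed.

(** The factor $q^{-1}$ in $T_2^{-1}$ turns $q^{-n}$ into $q^{-(n+1)}$, so the coefficients stay
    polynomial. *)
Lemma is_expansion_step (n : nat) (c : hecke_coefs {poly R[i]}) :
  is_expansion iota n c -> is_expansion iota n.+1 (hecke_step 'X c).
Proof.
have q0 : q != 0 := q_in_neq0 iota.
rewrite !is_expansionE expgSr => en.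
rewrite (rhoM q0) en (rhoM q0) rho_sigma // rho_sigmaV /Tinv.
rewrite (map_hecke_step poly_in_rmorphism).
rewrite (hecke_comb_step (q := q)); last first.
  by split=> [|i]; [exact: T_braid|exact: T_quad].
by rewrite -scalerAr -scalerAl -scalerAr scalerA exprSr invfM.
Qed.

Lemma is_expansion0 : is_expansion iota 0 (HeckeCoefs 1 0 0 0 0 0).
Proof.
rewrite is_expansionE expg0 rho1 ?q_in_neq0 // expr0 invr1 scale1r.
have p0 : poly_in iota 0 = 0 := rmorph0 poly_in_rmorphism.
have p1 : poly_in iota 1 = 1 := rmorph1 poly_in_rmorphism.
by rewrite /hecke_comb /= p0 p1 !scale0r !addr0 scale1r.
Qed.

End Expansion.

Theorem theorem3p2 (R : realType) (K : fieldType)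
    (iota : {rmorphism {fraction {poly R[i]}} -> K}) :
  (forall n : nat, (1 <= n)%N ->
     exists! c : hecke_coefs {poly R[i]}, is_expansion iota n c) /\
  (forall C : nat -> hecke_coefs {poly R[i]},
     (forall n : nat, (1 <= n)%N -> is_expansion iota n (C n)) ->
     forall n : nat, (2 <= n)%N ->
     let q : {poly R[i]} := 'X in
     let D := C n.-1 in
     c_0 (C n) = q ^+ 2 * c_21 D - q * (q - 1) * c_1 D /\
     c_1 (C n) = - (q - 1) ^+ 2 * c_1 D - (q - 1) * c_0 D + q ^+ 2 * c_121 D /\
     c_2 (C n) = q * c_1 D /\
     c_12 (C n) = (q - 1) * c_1 D + c_0 D /\
     c_21 (C n) = - (q - 1) * c_2 D + q * c_12 D
                  - (q - 1) ^+ 2 * c_21 D + q * (q - 1) * c_121 D /\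
     c_121 (C n) = c_2 D + (q - 1) * c_21 D).
Proof.
split=> [n _|C expC n n2 q D].
  (* The induction starts at the trivial power $n = 0$, so $n = 1$ needs no separate computation. *)
  have: exists c, is_expansion iota n c.
    elim: n => [|n [c /is_expansion_step]]; last by exists (hecke_step 'X c).
    by exists (HeckeCoefs 1 0 0 0 0 0); apply: is_expansion0.
  by case=> c ec; exists c; split=> // d; apply: is_expansion_uniq.
have -> : C n = hecke_step q D.
  apply: (is_expansion_uniq (expC n (ltnW n2))).
  (* After the shift, [n2] reads [2 <= n.+1], which is [1 <= n] by conversion, as [expC]
     requires. *)
  by case: n n2 @D => [//|n] n2 D; apply/is_expansion_step/(expC n n2).
by [].
Qed.
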